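(* Consider a finite irreducible Markov renewal process with state space $S=\{1,\dots,m\}$, embedded chain transition matrix $P$ with stationary probability vector $\pi$, mean sojourn time vector $\mu$, $\lambda=\pi^T\mu>0$, mean first passage times $m_{ij}$, and stationary probability vector $\varpi$ of the associated semi-Markov process. Then the sum $$k_i^{\circ(2)}=\sum_{j=1,\,j\neq i}^m\varpi_jm_{ij}$$ is a constant $K_C^{\circ(2)}$, the same for all $i\in S$ (i.e. $k^{\circ(2)}=K_C^{\circ(2)}e$), and this constant has the following equivalent forms: (a) If $G$ is any g-inverse of $I-P$, then $$K_C^{\circ(2)}=e^T\left(G_d-\tfrac1\lambda(G\mu\pi^T)_d\right)\mu.$$ (b) If $Z=[I-P+\Pi]^{-1}$, then $$K_C^{\circ(2)}=e^T\left(Z_d-\tfrac1\lambda(Z\mu\pi^T)_d\right)\mu.$$ (c) If $A^{\#}$ is the group inverse of $I-P$, then $$K_C^{\circ(2)}=e^T\left(A^{\#}_d-\tfrac1\lambda(A^{\#}\mu\pi^T)_d\right)\mu.$$ (d) If $\widetilde G=[I-P+\mu u^T]^{-1}$, where $u\in\mathbb{R}^m$ satisfies $u^Te\neq0$, then $$K_C^{\circ(2)}=-\frac{1}{u^Te}+e^T\widetilde G_d\,\mu.$$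
   Context: A Markov renewal process (MRP) $\{(X_n,T_n),n\ge 0\}$ on $S=\{1,\dots,m\}$ has $T_0=0\le T_1\le T_2\le\cdots$ and semi-Markov kernel $Q_{ij}(t)=P\{X_{n+1}=j,\ T_{n+1}-T_n\le t\mid X_n=i\}$ (Markov property: conditionally on the past up to step $n$, the law of $(X_{n+1},T_{n+1}-T_n)$ depends only on $X_n$, through this kernel). The embedded Markov chain $\{X_n\}$ has transition matrix $P=[p_{ij}]$, $p_{ij}=Q_{ij}(+\infty)$; the MRP is called irreducible when $P$ is irreducible. Put $\mu_{ij}=\int_0^\infty t\,dQ_{ij}(t)$, assumed finite, and $\mu_i=\sum_k\mu_{ik}$, the mean sojourn time on a visit to state $i$; $\mu=(\mu_1,\dots,\mu_m)^T$. $\pi=(\pi_1,\dots,\pi_m)^T$ is the unique vector with $\pi^TP=\pi^T$, $\pi^Te=1$, where $e=(1,\dots,1)^T$; $\Pi=e\pi^T$. $\lambda=\pi^T\mu$, assumed positive. The associated semi-Markov process is $X(t)=X_n$ for $T_n\le t<T_{n+1}$; its stationary probability vector $\varpi$ is given by $\varpi_j=\pi_j\mu_j/\lambda$. The mean first passage time is $m_{ij}=E[T_{ij}\mid X_0=i]$, where $T_{ij}=T_n$ with $n=\min\{r\ge1: X_r=j\}$ given $X_0=i$ (the return time if $i=j$); these are all finite. For a square matrix $X$, $X_d$ is the diagonal matrix with the same diagonal as $X$. A g-inverse (one-condition generalized inverse) of $I-P$ is any matrix $G$ with $(I-P)G(I-P)=I-P$. The group inverse $A^{\#}$ of $A=I-P$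 is the unique matrix with $AA^{\#}A=A$, $A^{\#}AA^{\#}=A^{\#}$, $AA^{\#}=A^{\#}A$; it equals $Z-\Pi$. *)

(* Defs.v *)
From HB Require Import structures.
From mathcomp Require Import all_boot all_order all_algebra.
From mathcomp Require Import all_classical all_reals all_analysis.
Set Implicit Arguments.
Unset Strict Implicit.
Unset Printing Implicit Defensive.
Import Order.TTheory GRing.Theory Num.Theory.
Import numFieldNormedType.Exports.
Local Open Scope classical_set_scope.
Local Open Scope ring_scope.

(* The sigma-algebra generated by X_0, ..., X_n and T_0, ..., T_n. *)
Definition history (R : realType) (Omega : Type) (m : nat)
    (X : nat -> Omega -> 'I_m) (T : nat -> Omega -> R) (n : nat) :
    set (set Omega) :=
  <<s [set A | exists2 k, (k <= n)%N &
        (exists i : 'I_m, A = X k @^-1` [set i]) \/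
        (exists2 B : set R, measurable B & A = T k @^-1` B)] >>.

(* Under Pr, (X_n, T_n) is a Markov renewal process with semi-Markov kernel Q,
   the law of X_0 being left free.  The last field is the statement
     Pr(X_{n+1} = j, T_{n+1} - T_n <= t | history n) = Q_{X_n, j}(t)  a.s.,
   written as an equality of integrals over the events A of the history. *)
Record is_markov_renewal_process (R : realType) (d : measure_display)
    (Omega : measurableType d) (m : nat) (Pr : probability Omega R)
    (X : nat -> Omega -> 'I_m) (T : nat -> Omega -> R)
    (Q : 'I_m -> 'I_m -> cumulative R R) : Prop := IsMarkovRenewalProcess {
  mrp_measurable_state : forall n i, measurable (X n @^-1` [set i]);
  mrp_measurable_time : forall n, measurable_fun setT (T n);
  mrp_time0 : forall w, T 0%N w = 0;
  mrp_time_nondecreasing : forall n w, T n w <= T n.+1 w;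
  mrp_markov : forall (n : nat) (A : set Omega) (i j : 'I_m) (t : R),
    history X T n A ->
    Pr (A `&` [set w | X n w = i] `&`
        [set w | X n.+1 w = j /\ T n.+1 w - T n w <= t]) =
    (Pr (A `&` [set w | X n w = i]) * (Q i j t)%:E)%E }.

Definition embedded_transition (R : realType) (m : nat)
    (Q : 'I_m -> 'I_m -> cumulative R R) : 'M[R]_m :=
  \matrix_(i, j) lim (Q i j t @[t --> +oo]).

Definition irreducible_mx (R : realType) (m : nat) (P : 'M[R]_m) : Prop :=
  forall i j, exists2 n, (0 < n)%N & 0 < (P ^+ n) i j.

(* mu_ij, an extended real until it is assumed finite. *)
Definition mean_time (R : realType) (m : nat)
    (Q : 'I_m -> 'I_m -> cumulative R R) (i j : 'I_m) : \bar R :=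
  \int[lebesgue_stieltjes_measure (Q i j)]_(t in `[0%R, +oo[) t%:E.

Definition mean_sojourn (R : realType) (m : nat)
    (Q : 'I_m -> 'I_m -> cumulative R R) : 'cV[R]_m :=
  \col_i \sum_k fine (mean_time Q i k).

(* T_n for the least n >= 1 with X_n = j, and +oo if j is never entered. *)
Definition first_passage (R : realType) (Omega : Type) (m : nat)
    (X : nat -> Omega -> 'I_m) (T : nat -> Omega -> R) (j : 'I_m)
    (w : Omega) : \bar R :=
  match pselect (exists n, (0 < n)%N && (X n w == j)) with
  | left h => (T (ex_minn h) w)%:E
  | right _ => +oo%E
  end.

(* m_ij, where Pr i is the law of the process started in state i. *)
Definition mean_first_passage (R : realType) (d : measure_display)
    (Omega : measurableType d) (m : nat) (Pr : 'I_m -> probability Omega R)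
    (X : nat -> Omega -> 'I_m) (T : nat -> Omega -> R) (i j : 'I_m) : \bar R :=
  \int[Pr i]_w first_passage X T j w.

(* lambda = pi^T mu *)
Definition mean_rate (R : realType) (m : nat) (pi mu : 'cV[R]_m) : R :=
  (pi^T *m mu) 0 0.

Definition smp_stationary (R : realType) (m : nat) (pi mu : 'cV[R]_m) :
    'cV[R]_m :=
  \col_j (pi j 0 * mu j 0 / mean_rate pi mu).

Definition ones (R : realType) (m : nat) : 'cV[R]_m := const_mx 1.

(* A_d *)
Definition diag_part (R : realType) (m : nat) (A : 'M[R]_m) : 'M[R]_m :=
  diag_mx (\row_i A i i).

Definition is_g_inverse (R : realType) (m : nat) (A G : 'M[R]_m) : Prop :=
  A *m G *m A = A.

Definition is_group_inverse (R : realType) (m : nat) (A G : 'M[R]_m) : Prop :=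
  [/\ A *m G *m A = A, G *m A *m G = G & A *m G = G *m A].

(* e^T (G_d - lambda^-1 (G mu pi^T)_d) mu *)
Definition kemeny_form (R : realType) (m : nat) (pi mu : 'cV[R]_m)
    (G : 'M[R]_m) : R :=
  ((ones R m)^T *m
   (diag_part G - (mean_rate pi mu)^-1 *: diag_part (G *m mu *m pi^T)) *m
   mu) 0 0.

(* Main.v *)
(* Let P_j be P with its j-th column set to zero.  Then (P_j^n)_ik is the
   probability that X_n = k and X_1, ..., X_n avoid j, starting from i, and the
   n-th sojourn has conditional mean mu_k, so that
     m_ij = sum_n (P_j^n mu)_i = ((I - P_j)^-1 mu)_i,
   the series converging because irreducibility makes P_j^n tend to zero.
   Hence the vector y_j with entries m_ij for i <> j and 0 at j satisfies the
   Poisson equation (I - P) y_j = mu - m_jj e_j.  Multiplying by pi^T gives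
   pi_j m_jj = lambda.  If G is a g-inverse of I - P, then y_j and
   G (mu - m_jj e_j) differ by a multiple of e, which the j-th entry determines;
   summing over j with the weights varpi_j cancels all dependence on i and
   leaves the form (a).  The matrices in (b), (c) and (d) are g-inverses. *)
Require Import Defs.
From HB Require Import structures.
From mathcomp Require Import all_boot all_order all_algebra.
From mathcomp Require Import all_classical all_reals all_analysis.
From mathcomp Require Import measurable_realfun.
Import Order.TTheory GRing.Theory Num.Theory.
Import numFieldNormedType.Exports.
Local Open Scope classical_set_scope.
Local Open Scope ring_scope.

Set Implicit Arguments.
Unset Strict Implicit.

(** * Powers of the taboo matrix of an irreducible stochastic matrix *)

Lemma unitmx_cV_ker (F : fieldType) (m : nat) (A : 'M[F]_m) :
  (forall v : 'cV[F]_m, A *m v = 0 -> v = 0) -> A \in unitmx.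
Proof.
move=> kerA; rewrite -unitmx_tr -row_free_unit -kermx_eq0.
apply/eqP/row_matrixP => i; rewrite row0.
have := row_sub i (kermx A^T); rewrite sub_kermx => /eqP.
move/(congr1 (@trmx F _ _)); rewrite trmx_mul trmxK trmx0 => /kerA.
by move/(congr1 (@trmx F _ _)); rewrite trmxK trmx0.
Qed.

(** The matrix [P_j]. Only the column of [j] is cleared, not its row: a path may start in [j], so
    return times are covered too. *)
Definition taboo (R : nmodType) (m : nat) (P : 'M[R]_m) (j : 'I_m) : 'M[R]_m :=
  \matrix_(i, k) (if k == j then 0 else P i k).

Section stochastic_matrix.
Variables (R : realType) (m : nat) (P : 'M[R]_m).
Hypothesis P_ge0 : forall i j, 0 <= P i j.
Hypothesis P_ones : P *m ones R m = ones R m.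
Hypothesis P_irr : irreducible_mx P.

Lemma mulmx_onesE (A : 'M[R]_m) i : (A *m ones R m) i 0 = \sum_k A i k.
Proof. by rewrite mxE; apply: eq_bigr => k _; rewrite mxE mulr1. Qed.

Lemma exp_ones n : (P ^+ n) *m ones R m = ones R m.
Proof.
elim: n => [|n IH]; first by rewrite expr0 mul1mx.
by rewrite exprS -mulmxA IH P_ones.
Qed.

Lemma taboo_exp_bounds j n i k :
  0 <= (taboo P j ^+ n) i k <= (P ^+ n) i k.
Proof.
elim: n i k => [|n IH] i k; first by rewrite !expr0 lexx mxE ler0n.
rewrite !exprS !mxE; apply/andP; split.
  apply: sumr_ge0 => l _; have /andP[h _] := IH l k.
  by rewrite mulr_ge0// mxE; case: ifP.
apply: ler_sum => l _; have /andP[h h'] := IH l k.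
by rewrite ler_pM// mxE; case: ifP.
Qed.

Let taboo_exp_ge0 j n i k : 0 <= (taboo P j ^+ n) i k.
Proof. by have /andP[] := taboo_exp_bounds j n i k. Qed.

(* Otherwise row i of P_j^n would be that of P^n, whose j-th entry is positive. *)
Lemma taboo_exp_sum_lt1 j i : exists n, \sum_k (taboo P j ^+ n) i k < 1.
Proof.
have [n n0 Pn] := P_irr i j; exists n; rewrite ltNge; apply/negP => le1.
have dif0 : \sum_k ((P ^+ n) i k - (taboo P j ^+ n) i k) == 0.
  rewrite eq_le sumr_ge0 ?andbT; last first.
    by move=> k _; rewrite subr_ge0; have /andP[] := taboo_exp_bounds j n i k.
  by rewrite sumrB subr_le0 -mulmx_onesE exp_ones mxE.
move: dif0; rewrite psumr_eq0; last first.
  by move=> k _; rewrite subr_ge0; have /andP[] := taboo_exp_bounds j n i k.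
move/allP => /(_ j (mem_index_enum _)) /=; rewrite subr_eq0 => /eqP Pj.
move: Pn; rewrite Pj; case: n n0 {Pj le1} => // n _.
rewrite exprSr mxE big1 ?ltxx// => k _.
by rewrite [taboo P j k j]mxE eqxx mulr0.
Qed.

(** Maximum principle: if [v] is nonzero and [|v_i|] is maximal, some power of the taboo matrix has
    [i]-th row sum below 1, and invariance under that power gives [|v_i| < |v_i|]. *)
Lemma taboo_fixed_eq0 j (v : 'cV[R]_m) : taboo P j *m v = v -> v = 0.
Proof.
move=> tv; apply/eqP/negP => /negP vn0.
have [i0 vi0] : exists i, v i 0 != 0.
  apply/existsP; move: vn0; apply: contraR; rewrite negb_exists => /forallP v0.
  by apply/eqP/colP => i; rewrite [RHS]mxE; apply/eqP; have := v0 i; rewrite negbK.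
have [i _ imax] := @Order.TotalTheory.arg_maxP _ _ _ i0 xpredT (fun i => `|v i 0|) isT.
have vi_gt0 : 0 < `|v i 0| by apply: lt_le_trans (imax i0 isT); rewrite normr_gt0.
have tnv n : taboo P j ^+ n *m v = v.
  elim: n => [|n IH]; first by rewrite expr0 mul1mx.
  by rewrite exprS -mulmxA IH tv.
have [n sum_lt1] := taboo_exp_sum_lt1 j i.
suff : `|v i 0| < `|v i 0| by rewrite ltxx.
rewrite -{1}(tnv n) mxE (le_lt_trans (ler_norm_sum _ _ _))//.
rewrite (@le_lt_trans _ _ (\sum_k (taboo P j ^+ n) i k * `|v i 0|))//.
  apply: ler_sum => k _; rewrite normrM (ger0_norm (taboo_exp_ge0 _ _ _ _)).
  by rewrite ler_wpM2l//; exact: imax.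
by rewrite -mulr_suml gtr_pMl.
Qed.

(** [P] and [taboo P j] differ only in column [j], and [v - v_j e] vanishes at [j]; so the taboo
    matrix fixes this vector, which must be zero. *)
Lemma ker_1sub (v : 'cV[R]_m) j :
  (1%:M - P) *m v = 0 -> v = v j 0 *: ones R m.
Proof.
rewrite mulmxBl mul1mx => /subr0_eq Pv; apply/subr0_eq.
apply: (@taboo_fixed_eq0 j); set w := v - _.
have -> : taboo P j *m w = P *m w.
  apply/colP => i; rewrite !mxE; apply: eq_bigr => k _.
  by rewrite [taboo P j i k]mxE; case: eqP => // ->; rewrite !mxE mulr1 subrr !mulr0.
by rewrite mulmxBr -scalemxAr P_ones -Pv.
Qed.

Lemma unitmx_1sub_taboo j : 1%:M - taboo P j \in unitmx.
Proof.
apply: unitmx_cV_ker => v; rewrite mulmxBl mul1mx => /subr0_eq/esym.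
exact: taboo_fixed_eq0.
Qed.

(** The row sums of the powers decrease in [n]. Their limits form a vector fixed by the taboo
    matrix, hence zero, and up to a constant the row sums dominate the sequence. *)
Lemma cvg_taboo_exp j (v : 'cV[R]_m) i :
  (taboo P j ^+ n *m v) i 0 @[n --> \oo] --> 0.
Proof.
pose r n k := \sum_l (taboo P j ^+ n) k l.
have rS n k : r n.+1 k = \sum_l taboo P j k l * r n l.
  rewrite /r; under eq_bigr do rewrite exprS mxE.
  by rewrite exchange_big/=; apply: eq_bigr => l _; rewrite mulr_sumr.
have r_ge0 n k : 0 <= r n k by apply: sumr_ge0.
have r_le1 k : r 1%N k <= 1.
  have <- : (P ^+ 1 *m ones R m) k 0 = 1 by rewrite exp_ones mxE.
  rewrite mulmx_onesE; apply: ler_sum => l _.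
  by have /andP[] := taboo_exp_bounds j 1 k l.
have rdecr n k : r n.+1 k <= r n k.
  elim: n k => [|n IH] k.
    apply: (le_trans (r_le1 k)); rewrite /r expr0.
    by rewrite -mulmx_onesE mul1mx mxE.
  rewrite rS [leRHS]rS; apply: ler_sum => l _; rewrite ler_wpM2l//.
  by have := taboo_exp_ge0 j 1 k l; rewrite expr1.
have r_cvg k : cvgn (r ^~ k).
  apply: nonincreasing_is_cvgn; first exact/nonincreasing_seqP.
  by exists 0 => _ [n _ <-].
pose s : 'cV[R]_m := \col_k limn (r ^~ k).
have s0 : s = 0.
  apply: (@taboo_fixed_eq0 j); apply/colP => k; rewrite mxE.
  have h1 : r n.+1 k @[n --> \oo] --> s k 0.
    by rewrite mxE (cvg_shiftS (r ^~ k)); exact: r_cvg.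
  suff h2 : r n.+1 k @[n --> \oo] --> \sum_l taboo P j k l * s l 0.
    exact: (cvg_unique _ h2 h1).
  rewrite (_ : (fun n => r n.+1 k) = (fun n => \sum_l taboo P j k l * r n l)).
    apply: cvg_big => [|l _]; first exact: add_continuous.
    by apply: cvgM; [exact: cvg_cst|rewrite mxE; exact: r_cvg].
  by apply/funext => n; rewrite rS.
pose V := \sum_k `|v k 0|.
have bound n : `|(taboo P j ^+ n *m v) i 0| <= r n i * V.
  rewrite mxE (le_trans (ler_norm_sum _ _ _))// mulr_suml.
  apply: ler_sum => k _; rewrite normrM (ger0_norm (taboo_exp_ge0 _ _ _ _)).
  by rewrite ler_wpM2l// /V (bigD1 k)//= lerDl sumr_ge0.
have rV : r n i * V @[n --> \oo] --> 0.
  rewrite -(mul0r V); apply: cvgM; last exact: cvg_cst.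
  have -> : 0 = limn (r ^~ i) by have /matrixP/(_ i 0) := s0; rewrite !mxE.
  exact: r_cvg.
apply/norm_cvg0P; apply: squeeze_cvgr (cvg_cst 0) rV.
by near=> n; rewrite normr_ge0 bound.
Unshelve. all: by end_near. Qed.

(** Neumann series: since [x = v + taboo P j *m x], the partial sums telescope to
    [x - taboo P j ^+ n *m x]. *)
Lemma taboo_series j (v : 'cV[R]_m) i :
  (\sum_(0 <= n <oo) ((taboo P j ^+ n *m v) i 0)%:E =
   ((invmx (1%:M - taboo P j) *m v) i 0)%:E)%E.
Proof.
set x := invmx _ *m v.
have xE : x = v + taboo P j *m x.
  by apply/eqP; rewrite -subr_eq -[X in X - _]mul1mx -mulmxBl mulKVmx ?unitmx_1sub_taboo.
have partial n :
    \sum_(0 <= k < n) (taboo P j ^+ k *m v) i 0 = x i 0 - (taboo P j ^+ n *m x) i 0.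
  elim: n => [|n IH]; first by rewrite big_geq// expr0 mul1mx subrr.
  rewrite big_nat_recr//= IH {2}xE mulmxDr mulmxA [X in _ - X + _]mxE.
  rewrite -[_ ^+ n *m taboo P j]exprSr.
  by rewrite opprD addrA addrAC subrK.
under eq_fun do rewrite sumEFin partial.
apply/cvg_lim => //; apply: cvg_EFin; first by near=> n.
rewrite -[X in _ --> X]subr0; apply: cvgB; first exact: cvg_cst.
exact: cvg_taboo_exp.
Unshelve. all: by end_near. Qed.

(** * Rank-one g-inverses, the Poisson equation and the weighted sum *)

Section kemeny.
Variables (pi mu : 'cV[R]_m).
Hypothesis piP : pi^T *m P = pi^T.

Lemma row_mul_cV (u v : 'cV[R]_m) : u^T *m v = ((u^T *m v) 0 0)%:M.
Proof. exact: mx11_scalar. Qed.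

Lemma pi_1sub : pi^T *m (1%:M - P) = 0.
Proof. by rewrite mulmxBr mulmx1 piP subrr. Qed.

Lemma mulmx_1sub_ones : (1%:M - P) *m ones R m = 0.
Proof. by rewrite mulmxBl mul1mx P_ones subrr. Qed.

(** For [v] in the kernel, multiplying by [pi^T] removes [1 - P] and leaves [u^T v = 0]. Then
    [(1 - P) v = 0], so [v = c e], and [c (u^T e) = 0] forces [c = 0]. *)
Lemma unitmx_1sub_rank1 (t u : 'cV[R]_m) :
  (pi^T *m t) 0 0 != 0 -> (u^T *m ones R m) 0 0 != 0 ->
  1%:M - P + t *m u^T \in unitmx.
Proof.
move=> pit ue; apply: unitmx_cV_ker => v; rewrite mulmxDl => Av0.
have uv : u^T *m v = 0.
  have := congr1 (mulmx pi^T) Av0.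
  rewrite mulmxDr !mulmxA pi_1sub mul0mx add0r mulmx0 -mulmxA row_mul_cV.
  rewrite mul_scalar_mx => /eqP; rewrite scaler_eq0 (negbTE pit) => /eqP.
  exact.
move: Av0; rewrite -mulmxA uv mulmx0 addr0 => /ker_1sub kv.
(* [ker_1sub] yields a constant only at a given index, so dimension zero is treated apart. *)
case: (m =P 0%N) => [m0|/eqP].
  by apply/colP => i; have := ltn_ord i; rewrite {2}m0.
rewrite -lt0n => m0; have {}kv := kv (Ordinal m0); set c := v _ 0 in kv.
have /eqP : c * (u^T *m ones R m) 0 0 = 0.
  by move/matrixP/(_ 0 0): uv; rewrite {1}kv -scalemxAr mxE => ->; rewrite mxE.
by rewrite mulf_eq0 (negbTE ue) orbF => /eqP c0; rewrite kv c0 scale0r.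
Qed.

Section rank1_inverse.
Variables t u : 'cV[R]_m.
Hypothesis pit : (pi^T *m t) 0 0 != 0.
Hypothesis ue : (u^T *m ones R m) 0 0 != 0.
Let A := 1%:M - P + t *m u^T.
Let A_unit : A \in unitmx := unitmx_1sub_rank1 pit ue.

(** As [1 - P] annihilates [e], one has [A e = (u^T e) t]. *)
Lemma invmx_rank1_mul : invmx A *m t = ((u^T *m ones R m) 0 0)^-1 *: ones R m.
Proof.
have Ae : A *m ones R m = (u^T *m ones R m) 0 0 *: t.
  by rewrite mulmxDl mulmx_1sub_ones add0r -mulmxA [u^T *m _ in LHS]row_mul_cV
    mul_mx_scalar.
by apply: (canRL (scalerK ue)); rewrite scalemxAr -Ae mulKmx.
Qed.

(** Dually, [pi^T A = (pi^T t) u^T], so [(1 - P) A^-1 = 1 - t pi^T / (pi^T t)]; multiplying by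
    [1 - P] on the right kills the second term. *)
Lemma g_inverse_rank1 : is_g_inverse (1%:M - P) (invmx A).
Proof.
rewrite /is_g_inverse.
have uA : u^T *m invmx A = ((pi^T *m t) 0 0)^-1 *: pi^T.
  have piA : pi^T *m A = (pi^T *m t) 0 0 *: u^T.
    by rewrite mulmxDr pi_1sub add0r mulmxA [pi^T *m t in LHS]row_mul_cV mul_scalar_mx.
  by apply: (canRL (scalerK pit)); rewrite scalemxAl -piA mulmxK.
have -> : (1%:M - P) *m invmx A = 1%:M - ((pi^T *m t) 0 0)^-1 *: (t *m pi^T).
  have E : 1%:M - P = A - t *m u^T by rewrite addrK.
  by rewrite {1}E mulmxBl mulmxV// -mulmxA uA -scalemxAr.
by rewrite mulmxBl mul1mx -scalemxAl -mulmxA pi_1sub mulmx0 scaler0 subr0.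
Qed.
End rank1_inverse.

Lemma ones_diag_mul (a : 'rV[R]_m) (v : 'cV[R]_m) :
  ((ones R m)^T *m diag_mx a *m v) 0 0 = \sum_j a 0 j * v j 0.
Proof.
rewrite mul_mx_diag mxE; apply: eq_bigr => j _.
by rewrite !mxE mul1r.
Qed.

Lemma mean_rateE : mean_rate pi mu = \sum_j pi j 0 * mu j 0.
Proof. by rewrite /mean_rate mxE; apply: eq_bigr => j _; rewrite mxE. Qed.

Lemma kemeny_formE (G : 'M[R]_m) :
  kemeny_form pi mu G = \sum_j G j j * mu j 0 -
    (mean_rate pi mu)^-1 * \sum_j (G *m mu) j 0 * pi j 0 * mu j 0.
Proof.
rewrite /kemeny_form /diag_part -linearZ -linearB/= ones_diag_mul mulr_sumr.
rewrite -sumrB; apply: eq_bigr => j _.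
do 6 rewrite mxE; rewrite big_ord1 [pi^T _ _]mxE.
by rewrite mulrBl !mulrA.
Qed.

Hypothesis rate_neq0 : mean_rate pi mu != 0.

(** With [t = mu] the vector [G mu] is [e / (u^T e)], so the subtracted term is
    [lambda^-1 lambda / (u^T e)]. *)
Lemma kemeny_form_rank1 (u : 'cV[R]_m) : (u^T *m ones R m) 0 0 != 0 ->
  kemeny_form pi mu (invmx (1%:M - P + mu *m u^T)) =
  - ((u^T *m ones R m) 0 0)^-1 +
  ((ones R m)^T *m diag_part (invmx (1%:M - P + mu *m u^T)) *m mu) 0 0.
Proof.
move=> ue; rewrite kemeny_formE invmx_rank1_mul// ones_diag_mul addrC.
set c := ((u^T *m _) 0 0)^-1; congr (- _ + _); last first.
  by apply: eq_bigr => j _; rewrite mxE.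
rewrite [X in _ * X](_ : _ = c * mean_rate pi mu).
  by rewrite mulrCA mulVf// mulr1.
rewrite mean_rateE mulr_sumr; apply: eq_bigr => j _.
by rewrite !mxE mulr1 mulrA.
Qed.

(** Algebraic counterpart of the [m_ij]; [mean_first_passageE] identifies it with the
    expectations. *)
Definition first_passage_mx : 'M[R]_m :=
  \matrix_(i, j) (invmx (1%:M - taboo P j) *m mu) i 0.

Let M := first_passage_mx.

Definition offdiag_first_passage j : 'cV[R]_m :=
  \col_i (if i == j then 0 else M i j).

Let Y := offdiag_first_passage.

Lemma offdiag_first_passageE j : Y j = col j M - M j j *: delta_mx j 0.
Proof.
apply/colP => i; rewrite [LHS]mxE [RHS]mxE [col j M i 0]mxE.
rewrite [X in _ + X]mxE [X in - X]mxE [delta_mx _ _ _ _]mxE eqxx andbT.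
by case: eqP => [->|_]; rewrite ?mulr1 ?subrr// mulr0 subr0.
Qed.

Lemma poisson_first_passage j :
  (1%:M - P) *m Y j = mu - M j j *: delta_mx j 0.
Proof.
have cE : col j M = invmx (1%:M - taboo P j) *m mu.
  by apply/colP => i; rewrite [LHS]mxE [LHS]mxE.
(* The taboo matrix ignores the [j]-th entry, the only one where [Y j] may differ from the column of
   [M]. *)
have tE : taboo P j *m col j M = P *m Y j.
  apply/colP => i; rewrite [LHS]mxE [RHS]mxE; apply: eq_bigr => k _.
  rewrite [taboo P j i k]mxE [Y j k 0]mxE [col j M k 0]mxE.
  by case: eqP; rewrite ?mulr0 ?mul0r.
have : (1%:M - taboo P j) *m col j M = mu by rewrite cE mulKVmx ?unitmx_1sub_taboo.
rewrite mulmxBl mul1mx tE => <-.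
by rewrite mulmxBl mul1mx offdiag_first_passageE addrAC.
Qed.

Lemma pi_first_passage j : pi j 0 * M j j = mean_rate pi mu.
Proof.
have := congr1 (mulmx pi^T) (poisson_first_passage j).
rewrite mulmxA pi_1sub mul0mx mulmxBr => /esym/subr0_eq /matrixP/(_ 0 0).
rewrite /mean_rate => ->; rewrite -scalemxAr -colE [RHS]mxE mulrC.
by rewrite [col _ _ _ _]mxE [pi^T _ _]mxE.
Qed.

(** Since [b = (1 - P) Y_j], the g-inverse property gives [(1 - P) G b = b]. So [Y_j - G b] is a
    constant vector, and [Y_j] being zero at [j] makes the constant [-(G b)_j]. *)
Lemma offdiag_first_passage_g_inverse (G : 'M[R]_m) i j :
  is_g_inverse (1%:M - P) G ->
  Y j i 0 = (G *m mu) i 0 - M j j * G i j + (M j j * G j j - (G *m mu) j 0).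
Proof.
move=> gG; set b := mu - M j j *: delta_mx j (0 : 'I_1).
have Gb l : (G *m b) l 0 = (G *m mu) l 0 - M j j * G l j.
  rewrite mulmxBr -scalemxAr -colE [LHS]mxE.
  by rewrite [X in _ + X]mxE [X in - X]mxE [col _ _ _ _]mxE.
have : (1%:M - P) *m (Y j - G *m b) = 0.
  by rewrite mulmxBr /b -poisson_first_passage !mulmxA gG subrr.
move=> /(ker_1sub j)/eqP; rewrite subr_eq => /eqP/colP/(_ i) ->.
rewrite [LHS]mxE addrC Gb; congr (_ + _).
rewrite mxE [ones R m i 0]mxE mulr1 mxE [Y j j 0]mxE eqxx add0r mxE Gb.
by rewrite opprB.
Qed.

Lemma sum_stationary_first_passage (G : 'M[R]_m) i : is_g_inverse (1%:M - P) G ->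
  \sum_(j | j != i) smp_stationary pi mu j 0 * M i j = kemeny_form pi mu G.
Proof.
move=> gG; rewrite kemeny_formE; set L := mean_rate pi mu.
(* By [pi_j M_jj = lambda]; this eliminates the mean return times from the sum. *)
have varpiM j : smp_stationary pi mu j 0 * M j j = mu j 0.
  rewrite mxE mulrAC [pi j 0 * _]mulrC -[mu j 0 * _ * _]mulrA pi_first_passage.
  by rewrite mulfK.
have varpi1 : \sum_j smp_stationary pi mu j 0 = 1.
  under eq_bigr do rewrite mxE.
  by rewrite -mulr_suml -mean_rateE mulfV.
transitivity (\sum_j smp_stationary pi mu j 0 * Y j i 0).
  rewrite [RHS](bigD1 i)//= [Y i i 0]mxE eqxx mulr0 add0r.
  by apply: eq_bigr => j ji; rewrite [Y j i 0]mxE eq_sym (negbTE ji).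
under eq_bigr => j _.
  rewrite (offdiag_first_passage_g_inverse i j gG) mulrDr !mulrBr !mulrA varpiM.
  over.
rewrite big_split/= !sumrB -mulr_suml varpi1 mul1r.
(* The first sum has become [(G mu)_i] because the weights add up to 1; the second, of [mu_j G_ij]
   over [j], is the same number, so the dependence on [i] cancels. *)
rewrite [X in _ - X](_ : _ = (G *m mu) i 0); last first.
  by rewrite mxE; apply: eq_bigr => j _; rewrite mulrC.
rewrite subrr add0r; congr (_ - _); first by apply: eq_bigr => j _; rewrite mulrC.
rewrite mulr_sumr; apply: eq_bigr => j _.
by rewrite [smp_stationary _ _ _ _]mxE mulrC [RHS]mulrC !mulrA.
Qed.

End kemeny.
End stochastic_matrix.

(** * Lebesgue-Stieltjes measures, and splitting along a finite-valued map *)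

Lemma lebesgue_stieltjes_measure_itv (R : realType) (f : cumulative R R) (a b : R) :
  a <= b -> lebesgue_stieltjes_measure f `]a, b]%classic = (f b - f a)%:E.
Proof.
move=> ab; rewrite /lebesgue_stieltjes_measure /measure_extension.
by rewrite measurable_mu_extE/= ?wlength_itv_bnd//; exact: is_ocitv.
Qed.

(** Half-open intervals are closed under intersection, generate the Borel sets and exhaust the line;
    on []a, b]], a difference of two rays, both measures equal [c (f b - f a)]. *)
Lemma measure_eq_scale_lebesgue_stieltjes (R : realType)
    (f : cumulative R R) (c : {nonneg R})
    (nu : {measure set (measurableTypeR R) -> \bar R}) :
  (forall t, nu `]-oo, t]%classic = (c%:num * f t)%:E) ->
  forall B, measurable B -> nu B = (c%:num%:E * lebesgue_stieltjes_measure f B)%E.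
Proof.
move=> nuf B mB; rewrite -[RHS]/(mscale c (lebesgue_stieltjes_measure f) B).
apply: (@measure_unique _ R (measurableTypeR R) (@ocitv R)
  (fun k : nat => `]- k%:R, k%:R]%classic)) => //.
- exact: ocitvI.
- by move=> k; exact: is_ocitv.
- exact: (bigcup_itvT false false).
- move=> _ [[a b] _ <-]/=.
  have [ab|ba] := leP a b; last first.
    by rewrite set_itv_ge ?measure0// -leNgt bnd_simp ltW.
  rewrite /mscale [X in (_ * X)%E]lebesgue_stieltjes_measure_itv// -EFinM mulrBr.
  have <- : `]-oo, b]%classic `\` `]-oo, a]%classic = `]a, b]%classic.
    apply/seteqP; split=> x /=; rewrite !in_itv/= -?ltNge.
      by move=> [-> /negP]; rewrite -ltNge => ->.
    by move=> /andP[ax ->]; split=> //; apply/negP; rewrite -ltNge.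
  rewrite measureD//=; last by rewrite nuf ltry.
  rewrite setIidr; last first.
    by move=> x /=; rewrite !in_itv/= => /le_trans; exact.
  by rewrite !nuf EFinB.
- move=> k; rewrite (@le_lt_trans _ _ (nu `]-oo, k%:R]%classic))//.
    apply: le_measure; rewrite ?inE.
    1,2: exact: measurable_itv.
    by move=> x /=; rewrite !in_itv/= => /andP[].
  by rewrite nuf ltry.
Qed.

Lemma setI_preimage_partition (T : Type) (m : nat) (Y : T -> 'I_m) (A : set T) :
  A = \big[setU/set0]_(k < m) (A `&` Y @^-1` [set k]).
Proof.
apply/seteqP; split=> w.
  by move=> Aw; rewrite -bigcup_seq; exists (Y w) => //=; exact: mem_index_enum.
by rewrite -bigcup_seq => -[k _ []].
Qed.

Lemma trivIset_setI_preimage (T : Type) (m : nat) (Y : T -> 'I_m) (A : set T) D :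
  trivIset D (fun k => A `&` Y @^-1` [set k]).
Proof. by move=> k l _ _ [w [[_ /= <-] [_ /= <-]]]. Qed.

Lemma measure_sum_preimage d (Omega : measurableType d) (R : realType)
    (mu : {measure set Omega -> \bar R}) (m : nat) (Y : Omega -> 'I_m) (A : set Omega) :
  measurable A -> (forall k, measurable (Y @^-1` [set k])) ->
  (mu A = \sum_k mu (A `&` Y @^-1` [set k]))%E.
Proof.
move=> mA mY; rewrite {1}(setI_preimage_partition Y A) measure_bigsetU_ord//.
- by move=> k; exact: measurableI.
- exact: trivIset_setI_preimage.
Qed.

Lemma ge0_integral_sum_preimage d (Omega : measurableType d) (R : realType)
    (mu : {measure set Omega -> \bar R}) (m : nat) (Y : Omega -> 'I_m) (A : set Omega)
    (f : Omega -> \bar R) :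
  measurable A -> (forall k, measurable (Y @^-1` [set k])) ->
  measurable_fun A f -> (forall w, A w -> (0 <= f w)%E) ->
  (\int[mu]_(w in A) f w = \sum_k \int[mu]_(w in A `&` Y @^-1` [set k]) f w)%E.
Proof.
move=> mA mY mf f0; rewrite {1}(setI_preimage_partition Y A).
rewrite ge0_integral_bigsetU//.
- by move=> k; exact: measurableI.
- exact: index_enum_uniq.
- exact: trivIset_setI_preimage.
- by rewrite -setI_preimage_partition.
- by rewrite -setI_preimage_partition.
Qed.

(** * Conditional laws of the sojourn times and of the embedded chain *)

Section renewal.
Variables (R : realType) (d : measure_display) (Omega : measurableType d) (m : nat).
Variables (Pr : probability Omega R) (X : nat -> Omega -> 'I_m) (T : nat -> Omega -> R).
Variable (Q : 'I_m -> 'I_m -> cumulative R R).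
Hypothesis H : is_markov_renewal_process Pr X T Q.

Local Notation at_ n k := (X n @^-1` [set k]).

Let measurable_at n k : measurable (at_ n k).
Proof. exact: (mrp_measurable_state H). Qed.

Let gap n w := T n.+1 w - T n w.

Let gap_ge0 n w : 0 <= gap n w.
Proof. by rewrite subr_ge0 (mrp_time_nondecreasing H). Qed.

Let measurable_gap n : measurable_fun setT (gap n).
Proof. by apply: measurable_funB; exact: (mrp_measurable_time H). Qed.

Lemma history_measurable n A : history X T n A -> measurable A.
Proof.
apply: smallest_sub; first exact: sigma_algebra_measurable.
move=> _ [k _ [[i ->]|[B mB ->]]]; first exact: measurable_at.
by rewrite -[_ @^-1` _]setTI; exact: (mrp_measurable_time H).
Qed.

Lemma historyS n A : history X T n A -> history X T n.+1 A.
Proof.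
apply: smallest_sub; first exact: smallest_sigma_algebra.
move=> B [k kn h]; apply: sub_sigma_algebra; exists k => //; exact: leqW.
Qed.

Lemma history_state n i : history X T n (at_ n i).
Proof. by apply: sub_sigma_algebra; exists n => //; left; exists i. Qed.

Lemma historyI n A B : history X T n A -> history X T n B -> history X T n (A `&` B).
Proof. exact: (@measurableI _ (g_sigma_algebraType _)). Qed.

Lemma historyC n A : history X T n A -> history X T n (~` A).
Proof. exact: (@measurableC _ (g_sigma_algebraType _)). Qed.

Lemma historyT n : history X T n setT.
Proof. exact: (@measurableT _ (g_sigma_algebraType _)). Qed.

(** The Markov property is the case of rays []-oo, t]]. For fixed [A], [k], [l] both sides are
    measures in [B], so they agree on all Borel sets. *)
Lemma gap_law n A k l B : history X T n A -> measurable B ->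
  (Pr (A `&` at_ n k `&` at_ n.+1 l `&` gap n @^-1` B) =
   Pr (A `&` at_ n k) * lebesgue_stieltjes_measure (Q k l) B)%E.
Proof.
move=> hA mB; have mA := history_measurable hA.
have mAk : measurable (A `&` at_ n k) by exact: measurableI.
have mD : measurable (A `&` at_ n k `&` at_ n.+1 l) by exact: measurableI.
pose c : {nonneg R} := NngNum (fine_ge0 (measure_ge0 Pr (A `&` at_ n k))).
have cE : (c%:num)%:E = Pr (A `&` at_ n k) by rewrite /= fineK// fin_num_measure.
pose nu_ : {measure set (measurableTypeR R) -> \bar R} :=
  pushforward (mrestr Pr mD) (gap n : Omega -> measurableTypeR R).
pose nu := nu_ (measurable_gap n).
have nuE C : nu C = Pr (A `&` at_ n k `&` at_ n.+1 l `&` gap n @^-1` C).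
  by rewrite /nu/= /pushforward /mrestr setIC.
rewrite -nuE -cE; apply: measure_eq_scale_lebesgue_stieltjes => // t.
rewrite nuE EFinM cE -(mrp_markov H)//; congr (Pr _).
by apply/seteqP; split=> w /=; rewrite in_itv/=; tauto.
Qed.

Lemma integral_gap n A k l : history X T n A ->
  (\int[Pr]_(w in A `&` at_ n k `&` at_ n.+1 l) (gap n w)%:E =
   Pr (A `&` at_ n k) * mean_time Q k l)%E.
Proof.
move=> hA; have mA := history_measurable hA.
have mAk : measurable (A `&` at_ n k) by exact: measurableI.
have mD : measurable (A `&` at_ n k `&` at_ n.+1 l) by exact: measurableI.
set D := _ `&` at_ n.+1 l in mD *.
have mf : measurable_fun setT (EFin \o gap n).
  by apply/measurable_EFinP; exact: measurable_gap.
have preim : gap n @^-1` `[0, +oo[%classic = setT.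
  by apply/seteqP; split=> // w _ /=; rewrite in_itv/= andbT gap_ge0.
(* The restriction to [D] moves from the domain to the measure, which can then be pushed forward
   along [gap n]. *)
transitivity (\int[mrestr Pr mD]_w (gap n w)%:E)%E.
  rewrite (@ge0_negligible_integral _ _ _ _ setT (~` D))//.
  - rewrite setTD setCK; apply: eq_measure_integral => B _ BD.
    by rewrite /= /mrestr setIidl.
  - exact: measurableC.
  - by move=> w _; rewrite lee_fin gap_ge0.
  - by rewrite /= /mrestr setICl measure0.
(* [mean_time] integrates over [[0, +oo[], whose preimage is the whole space because gaps are
   nonnegative. *)
rewrite -preim.
rewrite -[LHS](@ge0_integral_pushforward _ _ _ (measurableTypeR R) _ (gap n)
  (measurable_gap n) (mrestr Pr mD) `[0, +oo[%classic EFin)//.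
  pose c : {nonneg R} := NngNum (fine_ge0 (measure_ge0 Pr (A `&` at_ n k))).
  have cE : (c%:num)%:E = Pr (A `&` at_ n k) by rewrite /= fineK// fin_num_measure.
  rewrite (@eq_measure_integral _ _ _ _ (mscale c (lebesgue_stieltjes_measure (Q k l)))).
    rewrite ge0_integral_mscale//; first by rewrite cE.
      by move=> t; rewrite /= in_itv/= andbT lee_fin.
    exact: measurable_gap.
  move=> mg B mB _; rewrite /= /mscale cE -gap_law//.
  by rewrite /pushforward /mrestr setIC.
by move=> t; rewrite inE/= in_itv/= andbT lee_fin.
Qed.

(** [lim] is informative only once the limit exists. A sure start in [k] makes [Q k l t] a
    probability, hence bounded by 1, and it is monotone in [t]. *)
Lemma embedded_transition_cvg k l : Pr (at_ 0 k) = 1%E ->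
  Q k l t @[t --> +oo] --> embedded_transition Q k l.
Proof.
move=> start.
have m1 t : measurable [set w | X 1%N w = l /\ T 1%N w - T 0%N w <= t].
  rewrite (_ : [set _ | _] = at_ 1 l `&` gap 0 @^-1` `]-oo, t]%classic).
    by apply: measurableI => //; rewrite -[_ @^-1` _]setTI; exact: measurable_gap.
  by apply/seteqP; split=> w; rewrite /= in_itv.
have Qle t : Q k l t <= 1.
  have := mrp_markov H k l t (@historyT 0%N).
  rewrite setTI start mul1e -lee_fin => <-; apply: probability_le1.
  by apply: measurableI; [exact: measurable_at|exact: m1].
rewrite mxE; apply: cvgP; apply: nondecreasing_cvgr.
  exact: cumulative_is_nondecreasing.
by exists 1 => _ [t _ <-].
Qed.

(** The events with gap at most [N] increase to the whole event, so the kernel identity passes to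
    the limit along the integers. *)
Lemma transition_prob n A k l (p : R) : Q k l t @[t --> +oo] --> p ->
  history X T n A ->
  (Pr (A `&` at_ n k `&` at_ n.+1 l) = Pr (A `&` at_ n k) * p%:E)%E.
Proof.
move=> Qp hA; have mA := history_measurable hA.
have mAk : measurable (A `&` at_ n k) by exact: measurableI.
pose F N := A `&` at_ n k `&` (at_ n.+1 l `&` gap n @^-1` `]-oo, N%:R]%classic).
have mF N : measurable (F N).
  apply: measurableI => //; apply: measurableI => //.
  by rewrite -[_ @^-1` _]setTI; exact: measurable_gap.
have UF : \bigcup_N F N = A `&` at_ n k `&` at_ n.+1 l.
  rewrite -setI_bigcupr -setI_bigcupr -preimage_bigcup; congr (_ `&` _).
  rewrite [X in _ `&` X](_ : _ = setT) ?setIT// -subTset => w _ /=.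
  by exists (Num.truncn (gap n w)).+1 => //=; rewrite in_itv/= ltW// truncnS_gt.
have cvgF : (Pr \o F) N @[N --> \oo] --> Pr (A `&` at_ n k `&` at_ n.+1 l).
  rewrite -UF; apply: nondecreasing_cvg_mu => //; first exact: bigcup_measurable.
  move=> M N MN; apply/subsetPset => w [Aw [lw]] /=; rewrite in_itv/= => gw.
  by split=> //; split=> //=; rewrite in_itv/= (le_trans gw)// ler_nat.
have PrF N : Pr (F N) = (Pr (A `&` at_ n k) * (Q k l N%:R)%:E)%E.
  by rewrite -(mrp_markov H).
apply: (cvg_unique _ cvgF) => //.
rewrite (_ : Pr \o F = fun N : nat => (Pr (A `&` at_ n k) * (Q k l N%:R)%:E)%E).
  apply: cvgeZl; first exact: fin_num_measure.
  apply: cvg_EFin; first by near=> N.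
  by apply: (cvg_pinftyP _ _).1 Qp _ _; exact/cvgryPge/nbhs_infty_ger.
by apply/funext => N; exact: PrF.
Unshelve. all: by end_near. Qed.

(** * Avoidance of a state and mean first passage times *)

Definition unvisited j n : set Omega :=
  [set w | forall r, (0 < r <= n)%N -> X r w != j].

(** Time 0 does not count as a visit, even for a start in [j]; this makes [m_jj] a return time. *)
Lemma unvisited0 j : unvisited j 0 = setT.
Proof. by apply/seteqP; split=> // w _ [|r]. Qed.

Lemma unvisitedS j n : unvisited j n.+1 = unvisited j n `&` ~` at_ n.+1 j.
Proof.
apply/seteqP; split=> w.
  move=> uw; split=> [r /andP[r0 rn]|/= Xj]; first by rewrite uw// r0 leqW.
  by have := uw n.+1; rewrite leqnn Xj eqxx => /(_ isT).
move=> [uw /= /eqP Xj] r /andP[r0]; rewrite leq_eqVlt => /predU1P[->//|rn].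
by rewrite uw// r0.
Qed.

Lemma history_unvisited j n : history X T n (unvisited j n).
Proof.
elim: n => [|n IH]; first by rewrite unvisited0; exact: historyT.
rewrite unvisitedS; apply: historyI; first exact: historyS.
by apply: historyC; exact: history_state.
Qed.

Let measurable_unvisited j n : measurable (unvisited j n).
Proof. exact: history_measurable (@history_unvisited j n). Qed.

(** If [j] is first entered at step [N], [unvisited j n] holds exactly for [n < N] and the gaps
    telescope to [T_N]. On a path that never enters [j] the gaps may have a finite sum, so the
    second term supplies [+oo]. *)
Lemma first_passageE j w :
  (first_passage X T j w =
   \sum_(0 <= n <oo) ((EFin \o gap n) \_ (unvisited j n)) w +
   ((cst +oo) \_ (\bigcap_n unvisited j n)) w)%E.
Proof.
have h_ge0 n : (0 <= ((EFin \o gap n) \_ (unvisited j n)) w)%E.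
  by rewrite patchE; case: ifP => // _; rewrite lee_fin gap_ge0.
rewrite /first_passage; case: pselect => [hit|nohit]; last first.
  rewrite [X in (_ + X)%E]patchE ifT ?addey//.
    by rewrite gt_eqF// (lt_le_trans _ (nneseries_ge0 _))// ltNyr.
  rewrite inE => n _ r /andP[r0 _]; apply/negP => Xj.
  by apply: nohit; exists r; rewrite r0.
case: ex_minnP => N /andP[N0 XN] Nmin.
have unvE n : (w \in unvisited j n) = (n < N)%N.
  apply/idP/idP; rewrite inE.
    move=> uw; rewrite ltnNge; apply/negP => Nn.
    by have := uw N; rewrite N0 Nn XN => /(_ isT).
  move=> nN r /andP[r0 rn]; apply/negP => Xr.
  by have := Nmin r; rewrite r0 Xr => /(_ isT); rewrite leqNgt (leq_ltn_trans rn).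
rewrite [X in (_ + X)%E]patchE ifF ?adde0; last first.
  apply/negP; rewrite inE => /(_ N I) uw.
  by have := unvE N; rewrite ltnn => /negP; rewrite inE.
rewrite (nneseries_split 0 N)// add0n [X in (_ + X)%E]eseries0 ?adde0; last first.
  by move=> n Nn _; rewrite patchE unvE ltnNge Nn.
under eq_big_nat => n /andP[_ nN] do rewrite patchE unvE nN/=.
by rewrite sumEFin telescope_sumr// (mrp_time0 H) subr0.
Qed.

Variables (P : 'M[R]_m) (i : 'I_m).
Hypothesis QP : forall k l, Q k l t @[t --> +oo] --> P k l.
Hypothesis start : Pr (at_ 0 i) = 1%E.

(** Being in [j] at step [n+1] contradicts avoidance, which is the cleared column. For other states
    one splits along [X_n] and uses that [unvisited j n] belongs to the history. *)
Lemma unvisited_prob j n k :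
  Pr (unvisited j n `&` at_ n k) = ((taboo P j ^+ n) i k)%:E.
Proof.
elim: n k => [|n IH] k.
  rewrite unvisited0 setTI expr0 mxE; have [<-//|ik] := eqVneq.
  apply/eqP; rewrite -measure_le0 (@le_trans _ _ (Pr (~` at_ 0 i)))//.
    apply: le_measure; rewrite ?inE//; first exact: measurableC.
    by move=> w /= -> ki; rewrite ki eqxx in ik.
  by rewrite probability_setC// start subee.
rewrite exprSr mxE; have [->|kj] := eqVneq k j.
  rewrite unvisitedS -setIA setICl setI0 measure0 big1// => l _.
  by rewrite [taboo P j l j]mxE eqxx mulr0.
have -> : unvisited j n.+1 `&` at_ n.+1 k = unvisited j n `&` at_ n.+1 k.
  rewrite unvisitedS -setIA; congr (_ `&` _).
  by apply/seteqP; split=> w /= => [[]//|Xk]; split=> //; rewrite Xk; exact/eqP.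
rewrite (measure_sum_preimage _ (Y := X n)) ?sumEFin//; last exact: measurableI.
rewrite -sumEFin; apply: eq_bigr => l _.
rewrite setIAC; apply: (etrans (transition_prob (@QP l k) (@history_unvisited j n))).
by rewrite IH [taboo P j l k]mxE (negbTE kj) EFinM.
Qed.

Hypothesis mean_fin : forall k l, mean_time Q k l \is a fin_num.

(** Splitting along [X_n = k] and [X_{n+1} = l] factors each piece into a taboo probability and
    [mu_kl]; summing over [l] gives [mu_k]. *)
Lemma integral_gap_unvisited j n :
  (\int[Pr]_(w in unvisited j n) (gap n w)%:E =
   ((taboo P j ^+ n *m mean_sojourn Q) i 0)%:E)%E.
Proof.
have mgap (D : set Omega) : measurable_fun D (EFin \o gap n).
  by apply/measurable_EFinP; apply: measurable_funS (measurable_gap n).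
rewrite (ge0_integral_sum_preimage _ (Y := X n))//; last first.
  by move=> w _; rewrite lee_fin gap_ge0.
rewrite mxE -sumEFin; apply: eq_bigr => k _.
rewrite (ge0_integral_sum_preimage _ (Y := X n.+1))//; last 2 first.
  - exact: measurableI.
  - by move=> w _; rewrite lee_fin gap_ge0.
rewrite mxE mulr_sumr -sumEFin; apply: eq_bigr => l _.
rewrite integral_gap ?unvisited_prob; last exact: history_unvisited.
by rewrite EFinM fineK.
Qed.

Hypothesis P_ge0 : forall i j, 0 <= P i j.
Hypothesis P_ones : P *m ones R m = ones R m.
Hypothesis P_irr : irreducible_mx P.

(** The event lies in every [unvisited j n], whose probability is a row sum of the [n]-th taboo
    power and tends to zero. *)
Lemma unvisited_forever_prob j : Pr (\bigcap_n unvisited j n) = 0%E.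
Proof.
have mU : measurable (\bigcap_n unvisited j n) by exact: bigcapT_measurable.
apply/eqP; rewrite -measure_le0.
have h n : (Pr (\bigcap_n unvisited j n) <= ((taboo P j ^+ n *m ones R m) i 0)%:E)%E.
  rewrite mulmx_onesE -sumEFin; under eq_bigr do rewrite -unvisited_prob.
  rewrite -measure_sum_preimage//; apply: le_measure; rewrite ?inE//.
  by move=> w /(_ n I).
apply: (@cvge_to_ge _ \oo _ _ (fun n => ((taboo P j ^+ n *m ones R m) i 0)%:E)).
  apply: cvg_EFin; first by near=> n.
  exact: cvg_taboo_exp.
by near=> n; exact: h.
Unshelve. all: by end_near. Qed.

(** Termwise integration of the nonnegative gap series produces the Neumann series of [taboo P j] at
    [mu]. *)
Lemma mean_first_passageE j :
  (\int[Pr]_w first_passage X T j w =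
   (first_passage_mx P (mean_sojourn Q) i j)%:E)%E.
Proof.
have mU : measurable (\bigcap_n unvisited j n) by exact: bigcapT_measurable.
have mgap n : measurable_fun setT ((EFin \o gap n) \_ (unvisited j n)).
  apply/measurable_restrict => //; apply/measurable_EFinP.
  by apply: measurable_funS (measurable_gap n).
have gap0 n w : (0 <= ((EFin \o gap n) \_ (unvisited j n)) w)%E.
  by rewrite patchE; case: ifP => // _; rewrite lee_fin gap_ge0.
under eq_integral do rewrite first_passageE.
rewrite ge0_integralD//; last 4 first.
- by move=> w _; apply: nneseries_ge0 => n _ _; exact: gap0.
- exact: ge0_emeasurable_sum.
- by move=> w _; rewrite patchE; case: ifP => // _; exact: leey.
- by apply/measurable_restrict => //; exact: measurable_cst.
rewrite integral_nneseries//.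
rewrite -(integral_mkcond _ (cst +oo%E)) integral_cst//.
(* The infinite value sits on a null event, where [+oo] times 0 is 0. *)
rewrite [X in (_ * X)%E](unvisited_forever_prob j) mule0 adde0.
rewrite mxE -taboo_series//; apply: eq_eseriesr => n _.
by rewrite -integral_mkcond integral_gap_unvisited.
Qed.
End renewal.

(** * The constant and its equivalent forms *)

Unset Implicit Arguments.
Set Strict Implicit.

Theorem corollary2p2 (R : realType) (d : measure_display)
    (Omega : measurableType d) (m : nat)
    (Pr : 'I_m -> probability Omega R)
    (X : nat -> Omega -> 'I_m) (T : nat -> Omega -> R)
    (Q : 'I_m -> 'I_m -> cumulative R R) (pi : 'cV[R]_m)
    (P := embedded_transition Q) (mu := mean_sojourn Q)
    (e := ones R m) (lambda := mean_rate pi mu)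
    (varpi := smp_stationary pi mu)
    (mfp := mean_first_passage Pr X T)
    (hMRP : forall i, is_markov_renewal_process (Pr i) X T Q)
    (hstart : forall i, Pr i [set w | X 0%N w = i] = 1%E)
    (hirr : irreducible_mx P)
    (hmu : forall i j, mean_time Q i j \is a fin_num)
    (hpi : pi^T *m P = pi^T) (hpi1 : pi^T *m e = 1%:M)
    (hlambda : 0 < lambda) :
  exists K : R,
    [/\ forall i : 'I_m,
          (\sum_(j < m | j != i) (varpi j 0)%:E * mfp i j = K%:E)%E,
        forall G : 'M[R]_m, is_g_inverse (1%:M - P) G ->
          K = kemeny_form pi mu G,
        1%:M - P + e *m pi^T \in unitmx /\
          K = kemeny_form pi mu (invmx (1%:M - P + e *m pi^T)),
        forall Ash : 'M[R]_m, is_group_inverse (1%:M - P) Ash ->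
          K = kemeny_form pi mu Ash
      & forall u : 'cV[R]_m, (u^T *m e) 0 0 != 0 ->
          1%:M - P + mu *m u^T \in unitmx /\
          K = - ((u^T *m e) 0 0)^-1 +
              (e^T *m diag_part (invmx (1%:M - P + mu *m u^T)) *m mu) 0 0].
Proof.
have start k : Pr k (X 0%N @^-1` [set k]) = 1%E := hstart k.
have QP k l : Q k l t @[t --> +oo] --> P k l.
  exact: (embedded_transition_cvg (hMRP k)).
(* As one-step probabilities from a sure start, the entries of [P] are nonnegative with unit row
   sums. *)
have P_prob k l : (P k l)%:E = Pr k (X 0%N @^-1` [set k] `&` X 1%N @^-1` [set l]).
  have := transition_prob (hMRP k) (QP k l) (@historyT _ _ _ _ X T 0%N).
  by rewrite setTI start mul1e.
have mX (k : 'I_m) n l : measurable (X n @^-1` [set l]).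
  exact: (mrp_measurable_state (hMRP k)).
have P_ge0 k l : 0 <= P k l by rewrite -lee_fin P_prob measure_ge0.
have P_ones : P *m ones R m = ones R m.
  apply/colP => k; rewrite mulmx_onesE [RHS]mxE; apply: EFin_inj.
  rewrite -sumEFin; under eq_bigr do rewrite P_prob.
  by rewrite -measure_sum_preimage//; [exact: start|exact: mX|move=> l; exact: mX].
have mfpE i j : mfp i j = (first_passage_mx P mu i j)%:E.
  exact: (mean_first_passageE (hMRP i)).
have sumE i : (\sum_(j < m | j != i) (varpi j 0)%:E * mfp i j =
    (\sum_(j < m | j != i) varpi j 0 * first_passage_mx P mu i j)%:E)%E.
  by rewrite -sumEFin; apply: eq_bigr => j _; rewrite mfpE EFinM.
have rate_neq0 : mean_rate pi mu != 0 by rewrite gt_eqF.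
have kemeny G i : is_g_inverse (1%:M - P) G ->
    \sum_(j < m | j != i) varpi j 0 * first_passage_mx P mu i j = kemeny_form pi mu G.
  exact: sum_stationary_first_passage.
have pi_e : (pi^T *m e) 0 0 != 0 by rewrite hpi1 mxE eqxx oner_eq0.
(* Here [t = e] and [u = pi], so both nondegeneracy conditions are [pi^T e <> 0]. *)
have Z_unit := unitmx_1sub_rank1 P_ge0 P_ones hirr hpi pi_e pi_e.
have Z_ginv := g_inverse_rank1 P_ge0 P_ones hirr hpi pi_e pi_e.
(* [pi^T e = 1] excludes an empty state space; the sum at the reference state [i0] then links the
   forms of any two g-inverses. *)
have m_gt0 : (0 < m)%N.
  rewrite lt0n; apply: contraNneq pi_e => m0.
  by rewrite mxE big1// => k; have := ltn_ord k; rewrite {2}m0.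
pose i0 := Ordinal m_gt0.
have formE G : is_g_inverse (1%:M - P) G ->
    kemeny_form pi mu (invmx (1%:M - P + e *m pi^T)) = kemeny_form pi mu G.
  by move=> gG; rewrite -(kemeny _ i0 Z_ginv) (kemeny _ i0 gG).
exists (kemeny_form pi mu (invmx (1%:M - P + e *m pi^T))); split.
- by move=> i; rewrite sumE (kemeny _ i Z_ginv).
- exact: formE.
- by split.
- by move=> Ash [gA _ _]; exact: formE.
(* Here [t = mu], and the condition on [pi^T t] is [lambda <> 0]. *)
- move=> u ue; split; first exact: (unitmx_1sub_rank1 P_ge0 P_ones hirr hpi).
  rewrite -(kemeny_form_rank1 P_ge0 P_ones hirr hpi rate_neq0 ue); apply: formE.
  exact: (g_inverse_rank1 P_ge0 P_ones hirr hpi).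
Qed.
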